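(* Let $\Omega$ be a bounded Borel subset of $\mathbb{R}$ of positive Lebesgue measure. Assume that $\Omega$ is spectral with spectrum $\Lambda$, and let $U_\Lambda$ be the one-parameter unitary group on $L^2(\Omega)$ associated to $\Lambda$. Then $U_\Lambda$ is a unitary group of local translations on $\Omega$.
   Context: $|\Omega|$ denotes Lebesgue measure. For $\lambda\in\mathbb{R}$ put $e_\lambda(x)=e^{2\pi \mathrm{i}\lambda x}$. A Borel set $\Omega\subset\mathbb{R}$ of finite measure is spectral with spectrum $\Lambda\subset\mathbb{R}$ if $\{|\Omega|^{-1/2}e_\lambda:\lambda\in\Lambda\}$ is an orthonormal basis of $L^2(\Omega)$. A unitary group of local translations on $\Omega$ is a strongly continuous one-parameter unitary group $(U(t))_{t\in\mathbb{R}}$ on $L^2(\Omega)$ such that for every $f\in L^2(\Omega)$ and every $t\in\mathbb{R}$, $(U(t)f)(x)=f(x+t)$ for a.e. $x\in\Omega\cap(\Omega-t)$. If $\Omega$ is spectral with spectrum $\Lambda$, let $\mathcal{F}:L^2(\Omega)\to \ell^2(\Lambda)$, $\mathcal{F}f=\left(\langle f,|\Omega|^{-1/2}e_\lambda\rangle\right)_{\lambda\in\Lambda}$, and let $\hat U_\Lambda(t)(a_\lambda)_{\lambda\in\Lambda}=(e^{2\pi \mathrm{i}\lambda t}a_\lambda)_{\lambda\in\Lambda}$ on $\ell^2(\Lambda)$. The group associated to $\Lambda$ is $U_\Lambda(t)=\mathcal{F}^{-1}\hat U_\Lambda(t)\mathcal{F}$, $t\in\mathbb{R}$. *)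

(* Defs.v *)
From HB Require Import structures.
From mathcomp Require Import all_boot all_order all_algebra.
From mathcomp Require Import all_classical all_reals all_analysis.
From mathcomp Require Import measurable_realfun complex.

Set Implicit Arguments.
Unset Strict Implicit.
Unset Printing Implicit Defensive.

Import Order.TTheory GRing.Theory Num.Theory.
Import numFieldNormedType.Exports.
Import Normc.

Local Open Scope classical_set_scope.
Local Open Scope ring_scope.
Local Open Scope complex_scope.
Local Open Scope quotient_scope.

Section complex_integral.
Context d (T : measurableType d) (R : realType).
Variable mu : {measure set T -> \bar R}.
Implicit Types h k : T -> R[i].

Definition cintegral h : R[i] :=
  (\int[mu]_x complex.Re (h x)) +i* (\int[mu]_x complex.Im (h x)).

Definition cintegrable h :=
  mu.-integrable setT (EFin \o (fun x => complex.Re (h x))) /\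
  mu.-integrable setT (EFin \o (fun x => complex.Im (h x))).

Lemma eq_ae_cintegral h k : cintegrable h -> cintegrable k ->
  h = k %[ae mu] -> cintegral h = cintegral k.
Proof.
move=> [hR hI] [kR kI] hk; congr (_ +i* _); congr fine.
- apply: ae_eq_integral => //; [exact: (measurable_int mu)..|].
  by apply: filterS hk => x /[apply] /= ->.
- apply: ae_eq_integral => //; [exact: (measurable_int mu)..|].
  by apply: filterS hk => x /[apply] /= ->.
Qed.

Lemma cintegrableD h k : cintegrable h -> cintegrable k ->
  cintegrable (fun x => h x + k x).
Proof.
move=> [hR hI] [kR kI]; split.
- rewrite (_ : _ \o _ = (EFin \o (fun x => complex.Re (h x))) \+
    (EFin \o (fun x => complex.Re (k x))))%E; first exact: integrableD.
  by apply/funext => x /=; case: (h x) (k x) => ? ? [? ?].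
- rewrite (_ : _ \o _ = (EFin \o (fun x => complex.Im (h x))) \+
    (EFin \o (fun x => complex.Im (k x))))%E; first exact: integrableD.
  by apply/funext => x /=; case: (h x) (k x) => ? ? [? ?].
Qed.

Lemma cintegralD h k : cintegrable h -> cintegrable k ->
  cintegral (fun x => h x + k x) = cintegral h + cintegral k.
Proof.
move=> [hR hI] [kR kI]; rewrite /cintegral.
under [X in X +i* _]eq_Rintegral.
  move=> x _; rewrite (_ : complex.Re _ = complex.Re (h x) + complex.Re (k x)).
    by over.
  by case: (h x) (k x) => ? ? [? ?].
under [X in _ +i* X]eq_Rintegral.
  move=> x _; rewrite (_ : complex.Im _ = complex.Im (h x) + complex.Im (k x)).
    by over.
  by case: (h x) (k x) => ? ? [? ?].
by rewrite !RintegralD.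
Qed.

Lemma cintegrableZ (a : R[i]) h : cintegrable h ->
  cintegrable (fun x => a * h x).
Proof.
case: a => a b [hR hI]; split.
- rewrite (_ : _ \o _ =
    (fun x => a%:E * (EFin \o (fun x => complex.Re (h x))) x) \-
    (fun x => b%:E * (EFin \o (fun x => complex.Im (h x))) x))%E.
    by apply: integrableB => //; exact: integrableZl.
  by apply/funext => x /=; case: (h x).
- rewrite (_ : _ \o _ =
    (fun x => a%:E * (EFin \o (fun x => complex.Im (h x))) x) \+
    (fun x => b%:E * (EFin \o (fun x => complex.Re (h x))) x))%E.
    by apply: integrableD => //; exact: integrableZl.
  by apply/funext => x /=; case: (h x).
Qed.

Lemma cintegralZ (a : R[i]) h : cintegrable h ->
  cintegral (fun x => a * h x) = a * cintegral h.
Proof.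
case: a => a b [hR hI]; rewrite /cintegral.
have iZ c (f : T -> R) : mu.-integrable setT (EFin \o f) ->
    mu.-integrable setT (EFin \o (fun x => c * f x)).
  move=> intf; rewrite (_ : _ \o _ = fun x => c%:E * (EFin \o f) x)%E //.
  exact: integrableZl.
under [X in X +i* _]eq_Rintegral.
  move=> x _; rewrite (_ : complex.Re _ =
    a * complex.Re (h x) - b * complex.Im (h x)); first by over.
  by case: (h x).
under [X in _ +i* X]eq_Rintegral.
  move=> x _; rewrite (_ : complex.Im _ =
    a * complex.Im (h x) + b * complex.Re (h x)); first by over.
  by case: (h x).
rewrite RintegralB ?RintegralD //; try exact: iZ.
by rewrite !RintegralZl.
Qed.

Lemma cintegral_conj h : cintegrable h ->
  cintegral (fun x => (h x)^*) = (cintegral h)^*.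
Proof.
move=> [hR hI]; rewrite /cintegral /=; congr (_ +i* _).
  by apply: eq_Rintegral => x _; case: (h x).
under eq_Rintegral.
  move=> x _; rewrite (_ : complex.Im _ = -1 * complex.Im (h x)); first by over.
  by case: (h x) => ? ? /=; rewrite mulN1r.
by rewrite RintegralZl // mulN1r.
Qed.

End complex_integral.

Section L2_functions.
Context d (T : measurableType d) (R : realType).
Variable mu : {measure set T -> \bar R}.

Definition square_integrable : {pred T -> R[i]} :=
  mem [set f : T -> R[i] | [/\ measurable_fun setT (fun x => complex.Re (f x)),
                   measurable_fun setT (fun x => complex.Im (f x)) &
                   finite_norm mu 2%:E (fun x => normc (f x))]].

Lemma normcE (z : R[i]) :
  normc z = Num.sqrt (complex.Re z ^+ 2 + complex.Im z ^+ 2).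
Proof. by case: z. Qed.

Lemma Lfun2_lin (a b : R) (f g : T -> R) :
  f \in Lfun mu 2%:E -> g \in Lfun mu 2%:E ->
  (fun x => a * f x + b * g x) \in Lfun mu 2%:E.
Proof.
have [L0 Llin] := Lfun_submod_closed mu (lee1n 2).
move=> fL gL; apply: (Llin a _ _ fL).
by rewrite -[X in X \in _]addr0; exact: (Llin b _ _ gL).
Qed.

Lemma Lfun_normr (f : T -> R) :
  f \in Lfun mu 2%:E -> (fun x => `|f x|) \in Lfun mu 2%:E.
Proof.
rewrite !inE => /andP[]; rewrite !inE /= => mf ff; apply/andP.
rewrite !inE /=; split; first exact: measurableT_comp.
rewrite /finite_norm (_ : _ \o _ = abse \o (EFin \o f))//.
by rewrite Lnorm_abse.
Qed.

Lemma Lfun_le (f g : T -> R) : measurable_fun setT f ->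
  (forall x, `|f x| <= `|g x|) -> g \in Lfun mu 2%:E -> f \in Lfun mu 2%:E.
Proof.
move=> mf fg; rewrite !inE => /andP[]; rewrite !inE /= => mg gg; apply/andP.
rewrite !inE /=; split => //; move: gg; rewrite /finite_norm unlock.
apply: le_lt_trans; apply: gt0_ler_poweR.
- by rewrite invr_ge0.
- by rewrite in_itv/= leey integral_ge0// => x _; exact: poweR_ge0.
- by rewrite in_itv/= leey integral_ge0// => x _; exact: poweR_ge0.
have mp (h : T -> R) : measurable_fun setT h ->
    measurable_fun setT (fun x => (`|h x| `^ 2)%R).
  move=> mh; apply: (@measurableT_comp _ _ _ _ _ _ (fun x : R => x `^ 2)).
    by [].
  exact: measurableT_comp.
apply: ge0_le_integral => //=.
- by apply/measurable_EFinP; exact: mp.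
- by apply/measurable_EFinP; exact: mp.
by move=> x _; rewrite lee_fin ge0_ler_powR// nnegrE.
Qed.

Lemma square_integrableE (f : T -> R[i]) :
  (f \in square_integrable) = ((fun x => complex.Re (f x)) \in Lfun mu 2%:E) &&
                              ((fun x => complex.Im (f x)) \in Lfun mu 2%:E).
Proof.
have nR x : `|complex.Re (f x)| <= `|normc (f x)|.
  rewrite [leRHS]ger0_norm normcE ?sqrtr_ge0// -sqrtr_sqr ler_wsqrtr//.
  by rewrite lerDl sqr_ge0.
have nI x : `|complex.Im (f x)| <= `|normc (f x)|.
  rewrite [leRHS]ger0_norm normcE ?sqrtr_ge0// -sqrtr_sqr ler_wsqrtr//.
  by rewrite lerDr sqr_ge0.
have nD x : `|normc (f x)| <= `| `|complex.Re (f x)| + `|complex.Im (f x)| |.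
  rewrite [leRHS]ger0_norm ?addr_ge0// ger0_norm normcE ?sqrtr_ge0//.
  rewrite -[leRHS]ger0_norm ?addr_ge0// -sqrtr_sqr ler_wsqrtr//.
  rewrite sqrrD -!normrX [`|_ ^+ 2|]ger0_norm ?sqr_ge0//.
  rewrite [`|complex.Im _ ^+ 2|]ger0_norm ?sqr_ge0//.
  by rewrite addrAC lerDl mulrn_wge0// mulr_ge0.
have mn : measurable_fun setT (fun x => complex.Re (f x)) ->
    measurable_fun setT (fun x => complex.Im (f x)) ->
    measurable_fun setT (fun x => normc (f x)).
  move=> mR mI; rewrite (_ : (fun x => _) =
      fun x => (complex.Re (f x) ^+ 2 + complex.Im (f x) ^+ 2) `^ 2^-1).
    apply: (measurableT_comp (measurable_powR _)).
    by apply: measurable_funD; exact: measurable_funX.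
  by apply/funext => x; rewrite normcE powR12_sqrt// addr_ge0 ?sqr_ge0.
apply/idP/idP => [|/andP[fR fI]].
- rewrite inE /= => -[mR mI fn].
  have nL : (fun x => normc (f x)) \in Lfun mu 2%:E.
    by rewrite inE; apply/andP; rewrite !inE /=; split => //; exact: mn.
  by apply/andP; split; apply: Lfun_le nL.
- have mR : measurable_fun setT (fun x => complex.Re (f x)).
    by move: fR; rewrite inE => /andP[]; rewrite inE.
  have mI : measurable_fun setT (fun x => complex.Im (f x)).
    by move: fI; rewrite inE => /andP[]; rewrite inE.
  rewrite inE /=; split => //.
  have : (fun x => normc (f x)) \in Lfun mu 2%:E.
    apply: Lfun_le nD _; first exact: mn.
    rewrite (_ : (fun _ => _) = fun x => 1 * `|complex.Re (f x)| +
        1 * `|complex.Im (f x)|); last by apply/funext => x; rewrite !mul1r.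
    by apply: Lfun2_lin; exact: Lfun_normr.
  by rewrite inE => /andP[_]; rewrite inE.
Qed.

Lemma square_integrable_submod_closed : submod_closed square_integrable.
Proof.
split.
  rewrite inE; split; try exact: measurable_cst.
  rewrite /finite_norm (_ : _ \o _ = cst 0)%E ?Lnorm0//.
  by apply/funext => x; congr EFin; exact: normc0.
move=> [a b] f g; rewrite !square_integrableE => /andP[fR fI] /andP[gR gI].
have E x : ((a +i* b) *: f + g) x = (a +i* b) * f x + g x by [].
apply/andP; split.
- rewrite (_ : (fun x => _) = (fun x =>
    1 * (a * complex.Re (f x) + (- b) * complex.Im (f x)) +
    1 * complex.Re (g x))); last first.
    apply/funext => x; rewrite E !mul1r mulNr.
    by case: (f x) (g x) => ? ? [? ?].
  by do 2 apply: Lfun2_lin => //.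
- rewrite (_ : (fun x => _) = (fun x =>
    1 * (a * complex.Im (f x) + b * complex.Re (f x)) +
    1 * complex.Im (g x))); last first.
    apply/funext => x; rewrite E !mul1r.
    by case: (f x) (g x) => ? ? [? ?].
  by do 2 apply: Lfun2_lin => //.
Qed.

HB.instance Definition _ :=
  GRing.isSubmodClosed.Build _ _ square_integrable
    square_integrable_submod_closed.

Record L2fun := MkL2fun {
  L2fun_val :> T -> R[i] ;
  _ : L2fun_val \in square_integrable }.
HB.instance Definition _ := [isSub for L2fun_val].
HB.instance Definition _ := [Choice of L2fun by <:].
HB.instance Definition _ := [SubChoice_isSubLmodule of L2fun by <:].

End L2_functions.

Section L2_space.
Context d (T : measurableType d) (R : realType).
Variable mu : {measure set T -> \bar R}.
Implicit Types f g : L2fun mu.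

Definition L2fun_ae_eq f g := `[< (f : T -> R[i]) = g %[ae mu] >].

Let L2fun_ae_eq_refl : reflexive L2fun_ae_eq.
Proof. by move=> f; apply/asboolP; exact: aeW. Qed.

Let L2fun_ae_eq_sym : symmetric L2fun_ae_eq.
Proof.
by move=> f g; apply/idP/idP => /asboolP fg; apply/asboolP; exact: ae_eq_sym fg.
Qed.

Let L2fun_ae_eq_trans : transitive L2fun_ae_eq.
Proof.
by move=> g f h /asboolP fg /asboolP gh; apply/asboolP; exact: ae_eq_trans fg gh.
Qed.

Canonical L2fun_ae_eq_canonical :=
  EquivRel L2fun_ae_eq L2fun_ae_eq_refl L2fun_ae_eq_sym L2fun_ae_eq_trans.

Definition L2 : Type := {eq_quot L2fun_ae_eq}.
HB.instance Definition _ := Choice.on L2.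
HB.instance Definition _ := EqQuotient.on L2.

(* An element of L2 is used as a function through a chosen representative;
   only its a.e. class is meaningful. *)
Definition L2_to_fun (u : L2) : T -> R[i] := repr u.

Lemma L2_piP f g : (f : T -> R[i]) = g %[ae mu] <-> \pi_L2 f = \pi_L2 g.
Proof.
split=> [fg|/eqP]; first by apply/eqP; rewrite eqmodE; exact/asboolP.
by rewrite eqmodE => /asboolP.
Qed.

Lemma L2_reprK f : (repr (\pi_L2 f) : T -> R[i]) = f %[ae mu].
Proof. by apply/L2_piP; rewrite reprK. Qed.

Lemma L2_ind (P : L2 -> Prop) : (forall f, P (\pi_L2 f)) -> forall u, P u.
Proof. by move=> Pf u; rewrite -[u]reprK. Qed.

Definition L2_zero : L2 := \pi_L2 (0 : L2fun mu).
Definition L2_opp (u : L2) : L2 := \pi_L2 (- repr u).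
Definition L2_add (u v : L2) : L2 := \pi_L2 (repr u + repr v).
Definition L2_scale (a : R[i]) (u : L2) : L2 := \pi_L2 (a *: repr u).

Lemma L2_oppE f : L2_opp (\pi_L2 f) = \pi_L2 (- f).
Proof.
apply/L2_piP; apply: filterS (L2_reprK f) => x /(_ I) e _.
by congr (- _).
Qed.

Lemma L2_addE f g : L2_add (\pi_L2 f) (\pi_L2 g) = \pi_L2 (f + g).
Proof.
apply/L2_piP; apply: filterS2 (L2_reprK f) (L2_reprK g).
by move=> x /(_ I) ef /(_ I) eg _; congr (_ + _).
Qed.

Lemma L2_scaleE a f : L2_scale a (\pi_L2 f) = \pi_L2 (a *: f).
Proof.
apply/L2_piP; apply: filterS (L2_reprK f) => x /(_ I) e _.
by congr (_ * _).
Qed.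

Let L2_addA : associative L2_add.
Proof.
move=> u v w; elim/L2_ind: u => f; elim/L2_ind: v => g; elim/L2_ind: w => h.
by rewrite !L2_addE addrA.
Qed.

Let L2_addC : commutative L2_add.
Proof.
move=> u v; elim/L2_ind: u => f; elim/L2_ind: v => g.
by rewrite !L2_addE addrC.
Qed.

Let L2_add0 : left_id L2_zero L2_add.
Proof. by move=> u; elim/L2_ind: u => f; rewrite !L2_addE add0r. Qed.

Let L2_addN : left_inverse L2_zero L2_opp L2_add.
Proof. by move=> u; elim/L2_ind: u => f; rewrite L2_oppE L2_addE addNr. Qed.

HB.instance Definition _ :=
  GRing.isZmodule.Build L2 L2_addA L2_addC L2_add0 L2_addN.

Let L2_scaleA a b u : L2_scale a (L2_scale b u) = L2_scale (a * b) u.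
Proof. by elim/L2_ind: u => f; rewrite !L2_scaleE scalerA. Qed.

Let L2_scale1 : left_id 1 L2_scale.
Proof. by move=> u; elim/L2_ind: u => f; rewrite L2_scaleE scale1r. Qed.

Let L2_scaleDr : right_distributive L2_scale +%R.
Proof.
move=> a u v; elim/L2_ind: u => f; elim/L2_ind: v => g.
by rewrite -[X in L2_scale _ X]/(L2_add _ _) L2_addE !L2_scaleE scalerDr -L2_addE.
Qed.

Let L2_scaleDl u : {morph L2_scale^~ u : a b / a + b}.
Proof.
move=> a b; elim/L2_ind: u => f.
by rewrite !L2_scaleE scalerDl -L2_addE.
Qed.

HB.instance Definition _ := GRing.Zmodule_isLmodule.Build R[i] L2
  L2_scaleA L2_scale1 L2_scaleDr L2_scaleDl.

(* Linear in the first argument, conjugate-linear in the second. *)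
Definition L2_dot (u v : L2) : R[i] :=
  cintegral mu (fun x => L2_to_fun u x * (L2_to_fun v x)^*).

Lemma L2fun_cintegrable f g : cintegrable mu (fun x => f x * (g x)^*).
Proof.
have LR (h : L2fun mu) : (fun x => complex.Re (h x)) \in Lfun mu 2%:E.
  by have := valP h; rewrite /= square_integrableE => /andP[].
have LI (h : L2fun mu) : (fun x => complex.Im (h x)) \in Lfun mu 2%:E.
  by have := valP h; rewrite /= square_integrableE => /andP[].
have iM (h k : T -> R) : h \in Lfun mu 2%:E -> k \in Lfun mu 2%:E ->
    mu.-integrable setT (EFin \o (fun x => h x * k x)).
  by move=> hL kL; apply/Lfun1_integrable; exact: Lfun2_mul_Lfun1.
split.
- rewrite (_ : _ \o _ = (EFin \o (fun x => (complex.Re (f x) * complex.Re (g x))%R))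
    \+ (EFin \o (fun x => (complex.Im (f x) * complex.Im (g x))%R)))%E.
    by apply: integrableD => //; exact: iM.
  by apply/funext => x /=; case: (f x) (g x) => ? ? [? ?] /=; rewrite mulrN opprK.
- rewrite (_ : _ \o _ = (EFin \o (fun x => (complex.Im (f x) * complex.Re (g x))%R))
    \- (EFin \o (fun x => (complex.Re (f x) * complex.Im (g x))%R)))%E.
    by apply: integrableB => //; exact: iM.
  apply/funext => x /=; case: (f x) (g x) => ? ? [? ?] /=.
  by rewrite mulrN addrC.
Qed.

Lemma L2_dotE f g :
  L2_dot (\pi_L2 f) (\pi_L2 g) = cintegral mu (fun x => f x * (g x)^*).
Proof.
apply: eq_ae_cintegral; try exact: L2fun_cintegrable.
apply: filterS2 (L2_reprK f) (L2_reprK g).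
by rewrite /L2_to_fun => x /(_ I) -> /(_ I) ->.
Qed.

Let L2_dot_linear (w : L2) : linear_for *%R (L2_dot^~ w).
Proof.
move=> a u v; elim/L2_ind: u => f; elim/L2_ind: v => g; elim/L2_ind: w => h.
rewrite -[X in L2_dot X _]/(L2_add (L2_scale _ _) _) L2_scaleE L2_addE !L2_dotE.
have ifh := L2fun_cintegrable f h; have igh := L2fun_cintegrable g h.
rewrite -cintegralZ// -cintegralD//; last exact: cintegrableZ.
by congr cintegral; apply/funext => x; rewrite mulrA -mulrDl.
Qed.

Let L2_dot_herm (u v : L2) : L2_dot u v = (-1) ^+ false * conjc (L2_dot v u).
Proof.
elim/L2_ind: u => f; elim/L2_ind: v => g.
rewrite expr0 mul1r !L2_dotE -cintegral_conj; last exact: L2fun_cintegrable.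
by congr cintegral; apply/funext => x; rewrite rmorphM /= conjcK mulrC.
Qed.

Let L2_dot_linearr (w : L2) : linear_for (conjc \; *%R) (L2_dot w).
Proof.
move=> a u v; rewrite L2_dot_herm L2_dot_linear expr0 mul1r rmorphD rmorphM /=.
by rewrite [in RHS]L2_dot_herm [L2_dot w v]L2_dot_herm expr0 !mul1r.
Qed.

HB.instance Definition _ := @bilinear_isBilinear.Build R[i] L2 L2 R[i]
  *%R (conjc \; *%R) L2_dot (L2_dot_linear, L2_dot_linearr).

HB.instance Definition _ :=
  @isHermitianSesquilinear.Build R[i] L2 false conjc L2_dot L2_dot_herm.

Let L2_dot_gt0 (u : L2) : u != 0 -> 0 < L2_dot u u.
Proof.
elim/L2_ind: u => f f0; rewrite L2_dotE.
have [iR _] := L2fun_cintegrable f f.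
have ffE x : f x * (f x)^* = (complex.Re (f x) ^+ 2 + complex.Im (f x) ^+ 2)%:C.
  case: (f x) => a b /=; apply/eqP; rewrite eq_complex /=.
  by rewrite !expr2 !mulrN opprK [b * a]mulrC addNr !eqxx.
pose n x := complex.Re (f x * (f x)^*).
have n0 x : 0 <= n x by rewrite /n ffE /= addr_ge0 ?sqr_ge0.
rewrite (_ : cintegral _ _ = (\int[mu]_x n x)%:C); last first.
  rewrite /cintegral; congr (_ +i* _).
  under eq_Rintegral do rewrite ffE /=.
  by rewrite Rintegral_cst// mul0r.
rewrite ltcR lt_neqAle Rintegral_ge0// andbT eq_sym.
apply: contra f0 => /eqP n_eq0; apply/eqP/L2_piP.
have : (\int[mu]_x `|(EFin \o n) x|)%E = 0%E.
  under eq_integral do rewrite /= ger0_norm//.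
  rewrite -[LHS]fineK; first by congr EFin.
  exact: integrable_fin_num iR.
move/(ae_eq_integral_abs mu measurableT (measurable_int _ iR)).
apply: filterS => x /(_ I) /= [nx0] _.
move: nx0; rewrite ffE /= => /eqP.
rewrite paddr_eq0 ?sqr_ge0// !sqrf_eq0.
by case: (f x) => a b /= /andP[/eqP -> /eqP ->].
Qed.

HB.instance Definition _ := @isDotProduct.Build R[i] L2 L2_dot L2_dot_gt0.

End L2_space.

Coercion L2_to_fun : L2 >-> Funclass.

Section hilbert.
Context (R : realType) (H : lmodType R[i]) (dot : {dot H for conjc}).

Definition hnorm (u : H) : R := Num.sqrt (complex.Re (dot u u)).

Definition orthonormal_family (I : eqType) (e : I -> H) : Prop :=
  forall i j, dot (e i) (e j) = (i == j)%:R.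

(* A Hilbert basis: orthonormal with dense linear span. *)
Definition orthonormal_basis (I : eqType) (e : I -> H) : Prop :=
  orthonormal_family e /\
  forall (u : H) (eps : R), 0 < eps ->
    exists (s : seq I) (c : I -> R[i]),
      hnorm (u - \sum_(i <- s) c i *: e i) < eps.

Record unitary_operator (A : H -> H) : Prop := {
  unitary_linear : linear A ;
  unitary_dot : forall u v, dot (A u) (A v) = dot u v ;
  unitary_bij : bijective A }.

Record strongly_continuous_unitary_group (U : R -> H -> H) : Prop := {
  ugroup_unitary : forall t, unitary_operator (U t) ;
  ugroup0 : forall u, U 0 u = u ;
  ugroupD : forall s t u, U (s + t) u = U s (U t u) ;
  ugroup_continuous : forall u t, hnorm (U s u - U t u) @[s --> t] --> (0 : R) }.

Lemma dot_ge0 (u : H) : 0 <= dot u u.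
Proof.
have [->|u0] := eqVneq u 0; first by rewrite linear0l.
exact/ltW/neq0_dnorm_gt0.
Qed.

Lemma bessel_fin (I : eqType) (e : I -> H) (u : H) (s : seq I) :
    orthonormal_family e -> uniq s ->
  \sum_(i <- s) normc (dot u (e i)) ^+ 2 <= complex.Re (dot u u).
Proof.
move=> one us.
pose p := \sum_(i <- s) dot u (e i) *: e i.
have dup : dot u p = (\sum_(i <- s) normc (dot u (e i)) ^+ 2)%:C.
  rewrite /p linear_sumr rmorph_sum /=; apply: eq_bigr => i _.
  by rewrite linearZr_LR /= mulrC -sqr_normc rmorphXn.
have dpi i : i \in s -> dot p (e i) = dot u (e i).
  move=> si; rewrite /p linear_sumlz (bigD1_seq i) //= big1 ?addr0.
    by rewrite linearZl_LR /= one eqxx mulr1.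
  by move=> j ji; rewrite linearZl_LR /= one (negbTE ji) mulr0.
have dpp : dot p p = dot u p.
  rewrite {2 3}/p !linear_sumr !big_seq; apply: eq_bigr => i si.
  by rewrite !linearZr_LR /= dpi.
have dpu : dot p u = dot u p.
  rewrite hermC expr0 mul1r; change ((dot u p)^* = dot u p).
  by rewrite dup conjc_real.
have := dot_ge0 (u - p).
have -> : dot (u - p) (u - p) = dot u u - dot u p - (dot p u - dot p p).
  by rewrite linearBl !linearBr.
rewrite dpu dpp subrr subr0 dup subr_ge0.
by case: (dot u u) => a b; rewrite lecE /= => /andP[].
Qed.

End hilbert.

Section ell2.
Context (R : realType) (I : choiceType).

Definition square_summable : {pred I -> R[i]} :=
  mem [set a : I -> R[i] |
    (\esum_(i in [set: I]) (normc (a i) ^+ 2)%:E < +oo)%E].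

Record ell2 := MkEll2 {
  ell2_val :> I -> R[i] ;
  _ : ell2_val \in square_summable }.
HB.instance Definition _ := [isSub for ell2_val].
HB.instance Definition _ := [Choice of ell2 by <:].

Context (H : lmodType R[i]) (dot : {dot H for conjc}).

Lemma bessel (e : I -> H) (u : H) : orthonormal_family dot e ->
  (fun i => dot u (e i)) \in square_summable.
Proof.
move=> one; rewrite inE /=.
apply: (@le_lt_trans _ _ (complex.Re (dot u u))%:E); last exact: ltry.
apply: ge_ereal_sup => _ [A [finA _] <-].
rewrite fsbig_finite//= sumEFin lee_fin.
exact: bessel_fin.
Qed.

Definition coefficient_map (e : I -> H) (one : orthonormal_family dot e)
  (u : H) : ell2 := MkEll2 (bessel u one).

End ell2.

(* The class of f when f is square integrable; junk value 0 otherwise. *)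
Definition to_L2 d (T : measurableType d) (R : realType)
    (mu : {measure set T -> \bar R}) (f : T -> R[i]) : L2 mu :=
  \pi_(L2 mu) (insubd 0 f).

Section exponentials.
Context (R : realType).

Definition expo (lambda x : R) : R[i] :=
  cos (2 * pi * lambda * x) +i* sin (2 * pi * lambda * x).

Lemma normc_expo lambda x : normc (expo lambda x) = 1.
Proof. by rewrite /= cos2Dsin2 sqrtr1. Qed.

Lemma expo_square_integrable (mu : {measure set (measurableTypeR R) -> \bar R})
  (lambda : R) : (mu setT < +oo)%E -> expo lambda \in square_integrable mu.
Proof.
move=> muoo; have ml : measurable_fun setT (fun x : R => 2 * pi * lambda * x).
  exact: measurable_funM.
rewrite inE /=; split.
- apply: (@measurableT_comp _ _ _ _ _ _ (@cos R)) => //.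
  by apply: continuous_measurable_fun; exact: continuous_cos.
- apply: (@measurableT_comp _ _ _ _ _ _ (@sin R)) => //.
  by apply: continuous_measurable_fun; exact: continuous_sin.
rewrite /finite_norm (_ : _ \o _ = cst 1)%E; last first.
  by apply/funext => x; congr EFin; exact: normc_expo.
by rewrite Lnorm_cst1 poweR_lty.
Qed.

Definition modulate (Lambda : set R) (t : R) (a : Lambda -> R[i]) : Lambda -> R[i] :=
  fun l => expo (val l) t * a l.

Lemma modulate_square_summable (Lambda : set R) (t : R) (a : ell2 R Lambda) :
  modulate t a \in @square_summable R Lambda.
Proof.
have := valP a; rewrite !inE /=; congr (_ < _)%E.
by apply: eq_esum => l _; rewrite /modulate normcM normc_expo mul1r.
Qed.

Definition Uhat (Lambda : set R) (t : R) (a : ell2 R Lambda) : ell2 R Lambda :=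
  MkEll2 (modulate_square_summable t a).

End exponentials.

(* L^2(Omega) as L^2 of Lebesgue measure restricted to Omega: the representatives
   are Borel functions on the whole line, identified when equal a.e. on Omega,
   and all integrals only see their values on Omega. *)
Notation L2on mOmega := (L2 (mrestr lebesgue_measure mOmega)).

Section spectral_sets.
Context (R : realType) (Omega : set (measurableTypeR R)).
Variable mOmega : measurable Omega.
Local Notation leb := (@lebesgue_measure R).
Local Notation L2Omega := (L2on mOmega).

Definition L2on_dot : {dot L2Omega for conjc} :=
  @L2_dot _ _ _ (mrestr leb mOmega).

Definition normalized_expo (lambda : R) : L2Omega :=
  ((Num.sqrt (fine (leb Omega)))^-1)%:C *: to_L2 (mrestr leb mOmega) (expo lambda).

Definition is_spectrum (Lambda : set R) : Prop :=
  (leb Omega < +oo)%E /\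
  orthonormal_basis L2on_dot (fun l : Lambda => normalized_expo (val l)).

(* The points x of Omega with x + t in Omega are those of Omega `&` (Omega - t). *)
Definition local_translation_group (U : R -> L2Omega -> L2Omega) : Prop :=
  strongly_continuous_unitary_group L2on_dot U /\
  forall (f : L2Omega) (t : R),
    {ae leb, forall x : R, Omega x -> Omega (x + t) -> U t f x = f (x + t)}.

Section associated_group.
Variables (Lambda : set R) (spec : is_spectrum Lambda).

(* [bessel] makes the codomain l^2(Lambda); Parseval and Riesz-Fischer make this
   map bijective, so that [fourier_inv] is its genuine inverse. *)
Definition fourier : L2Omega -> ell2 R Lambda := coefficient_map spec.2.1.

Definition fourier_inv : ell2 R Lambda -> L2Omega :=
  'pinv_(fun=> 0) setT fourier.

Definition associated_group (t : R) (f : L2Omega) : L2Omega :=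
  fourier_inv (Uhat t (fourier f)).

End associated_group.
End spectral_sets.

(* Main.v *)
Require Import Defs.
From mathcomp Require Import all_boot all_order all_algebra.
From mathcomp Require Import all_classical all_reals all_analysis.
From mathcomp Require Import measurable_realfun complex ring lra.
Import Order.TTheory GRing.Theory Num.Theory.
Import numFieldNormedType.Exports.
Local Open Scope classical_set_scope.
Local Open Scope ring_scope.

Set Implicit Arguments.
Unset Strict Implicit.
Unset Printing Implicit Defensive.

(* On an exponential e_l, the group acts by e_l |-> e_l(t) e_l = e_l(. + t), so
   translation by t is exact on trigonometric polynomials p.  These are dense,
   U(t) is isometric, and for S = Omega `&` (Omega - t) translation invariance
   of Lebesgue measure bounds the L^2(S)-norm of f(. + t) - p(. + t) by the
   L^2(Omega)-norm of f - p; hence U(t) f = f(. + t) a.e. on S for every f.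
   For U(t) f to exist, (e_l(t) <f, e_l>)_l must lie in the range of the Fourier
   map: this follows from completeness of L^2 by approximating f by
   trigonometric polynomials and multiplying their coefficients by e_l(t).
   All estimates use |u + v|^2 <= 2 (|u|^2 + |v|^2) instead of the triangle
   inequality. *)

(** * The squared modulus of complex numbers *)

Section complex_modulus.
Local Open Scope complex_scope.
Context (R : rcfType).
Implicit Types z w : R[i].

Lemma sqr_normcE z :
  Normc.normc z ^+ 2 = complex.Re z ^+ 2 + complex.Im z ^+ 2.
Proof. by case: z => a b; rewrite sqr_sqrtr// addr_ge0 ?sqr_ge0. Qed.

Lemma sqr_normcD_le z w :
  Normc.normc (z + w) ^+ 2 <= 2 * (Normc.normc z ^+ 2 + Normc.normc w ^+ 2).
Proof.
rewrite !sqr_normcE; case: z w => a b [c d] /=; rewrite -subr_ge0.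
have -> : 2 * (a ^+ 2 + b ^+ 2 + (c ^+ 2 + d ^+ 2)) -
  ((a + c) ^+ 2 + (b + d) ^+ 2) = (a - c) ^+ 2 + (b - d) ^+ 2 by ring.
by rewrite addr_ge0 ?sqr_ge0.
Qed.

Lemma sqr_normcN z : Normc.normc (- z) ^+ 2 = Normc.normc z ^+ 2.
Proof. by rewrite !sqr_normcE; case: z => a b /=; rewrite !sqrrN. Qed.

Lemma mul_conjc_normc z : z * z^* = (Normc.normc z ^+ 2)%:C.
Proof. by rewrite rmorphXn /= sqr_normc. Qed.

End complex_modulus.

(** * Vanishing by geometric bounds *)

Section geometric_bound.
Context (R : realType).

(** Passage to the limit: it turns error bounds of order [4^-n] along an approximating sequence into
    exact vanishing. *)
Lemma le0_geometric (x c : R) : (forall n, x <= c * 4^-1 ^+ n) -> x <= 0.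
Proof.
move=> xc; have : (fun n => c * 4^-1 ^+ n) @ \oo --> (0 : R).
  rewrite -[X in _ --> X](mulr0 c); apply: cvgMr; apply: cvg_expr.
  by rewrite ger0_norm ?invr_ge0// invf_lt1// ltr1n.
move=> h; apply: (ler_cvg_to (cvg_cst x) h) => //=.
by apply: nearW => n /=; exact: xc.
Qed.

End geometric_bound.

(** * The squared norm of a complex inner product *)

Section square_norm.
Local Open Scope complex_scope.
Context (R : realType) (H : lmodType R[i]) (dot : {dot H for conjc}).
Implicit Types u v : H.

Definition sqnorm u : R := complex.Re (dot u u).

Lemma sqn_ge0 u : 0 <= sqnorm u.
Proof. by have := dot_ge0 dot u; rewrite lecE => /andP[]. Qed.

Lemma dotC u v : dot u v = (dot v u)^*.
Proof. by rewrite hermC expr0 mul1r. Qed.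

Lemma dot_sqn u : dot u u = (sqnorm u)%:C.
Proof.
have := dot_ge0 dot u; rewrite lecE /= /sqnorm.
by case: (dot u u) => a b /= /andP[/eqP -> _].
Qed.

Lemma hnorm_lt u (eps : R) : 0 < eps ->
  (hnorm dot u < eps) = (sqnorm u < eps ^+ 2).
Proof.
move=> e0; rewrite /hnorm -/(sqnorm u) -{1}[eps]gtr0_norm//.
rewrite -sqrtr_sqr ltr_sqrt//.
by rewrite exprn_gt0.
Qed.

Lemma sqnD u v :
  sqnorm (u + v) = sqnorm u + sqnorm v + 2 * complex.Re (dot u v).
Proof.
rewrite /sqnorm linearDl !linearDr /= [dot v u]dotC.
by case: (dot u u) (dot v v) (dot u v) => ? ? [? ?] [? ?] /=; ring.
Qed.

Lemma sqnZ (a : R[i]) u : sqnorm (a *: u) = Normc.normc a ^+ 2 * sqnorm u.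
Proof.
rewrite /sqnorm linearZl_LR linearZr_LR /= mulrA mul_conjc_normc dot_sqn /=.
by rewrite mul0r subr0.
Qed.

Lemma sqnN u : sqnorm (- u) = sqnorm u.
Proof. by rewrite /sqnorm linearNl linearNr /= opprK. Qed.

(** By the parallelogram law the gap between the two sides is [sqnorm (u - v)]. *)
Lemma sqnD_le u v : sqnorm (u + v) <= 2 * (sqnorm u + sqnorm v).
Proof.
have := sqn_ge0 (u - v); rewrite !sqnD sqnN linearNr /=.
case: (dot u v) => a b /=; lra.
Qed.

Lemma sqnB_le u v : sqnorm (u - v) <= 2 * (sqnorm u + sqnorm v).
Proof. by have := sqnD_le u (- v); rewrite sqnN. Qed.

Lemma sqn_dist_le v u w :
  sqnorm (u - w) <= 2 * (sqnorm (u - v) + sqnorm (v - w)).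
Proof. by rewrite -(subrKA v); exact: sqnD_le. Qed.

Lemma sqn_eq0 u : sqnorm u = 0 -> u = 0.
Proof.
move=> u0; apply/eqP; apply: contraT => un0.
have : 0 < dot u u by exact: neq0_dnorm_gt0.
by rewrite dot_sqn u0 ltxx.
Qed.

(** Polarization: expanding [sqnorm (u + v)] recovers the real part of the inner product, and
    replacing [u] by ['i *: u] recovers the imaginary part. *)
Lemma linear_sqn_dot (A : H -> H) : linear A ->
  (forall u, sqnorm (A u) = sqnorm u) -> forall u v, dot (A u) (A v) = dot u v.
Proof.
move=> linA isoA.
have ADr u v : A (u + v) = A u + A v by rewrite -[u]scale1r linA !scale1r.
have A0 : A 0 = 0 by apply: (addrI (A 0)); rewrite -ADr !addr0.
have AZ a u : A (a *: u) = a *: A u by rewrite -[a *: u]addr0 linA A0 addr0.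
have ReA u v : complex.Re (dot (A u) (A v)) = complex.Re (dot u v).
  have := isoA (u + v); rewrite ADr !sqnD !isoA => /addrI.
  by apply: mulfI; rewrite pnatr_eq0.
move=> u v; apply/eqP; rewrite eq_complex ReA eqxx /=.
have := ReA ('i *: u) v; rewrite AZ !linearZl_LR /=.
case: (dot u v) (dot _ _) => ? ? [? ?] /=.
by rewrite !mul0r !mul1r !sub0r => /oppr_inj ->.
Qed.

End square_norm.

(** * Orthonormal bases: Parseval and diagonal multipliers *)

Section basis.
Local Open Scope complex_scope.
Context (R : realType) (H : lmodType R[i]) (dot : {dot H for conjc}).
Context (I : eqType) (e : I -> H) (be : orthonormal_basis dot e).
Implicit Types u v : H.
Local Notation sqn := (sqnorm dot).
Local Notation normc := Normc.normc.

Lemma basis_dense u (eps : R) : 0 < eps ->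
  exists (s : seq I) (c : I -> R[i]), sqn (u - \sum_(i <- s) c i *: e i) < eps.
Proof.
move=> e0; have [s [c sc]] := be.2 u _ (etrans (sqrtr_gt0 eps) e0).
exists s, c; move: sc; rewrite hnorm_lt ?sqrtr_gt0//.
by rewrite sqr_sqrtr// ltW.
Qed.

(** Finite combinations of basis vectors are dense, so closure under limits carries [P] from them to
    all vectors. Existence of multiplied vectors, strong continuity and the translation property are
    all obtained by this induction. *)
Lemma basis_ind (P : H -> Prop) : P 0 ->
  (forall a i u, P u -> P (a *: e i + u)) ->
  (forall u, (forall eps : R, 0 < eps -> exists2 v, P v & sqn (u - v) < eps) ->
     P u) ->
  forall u, P u.
Proof.
move=> P0 PD Pcl u; apply: Pcl => eps /(basis_dense u)[s [c sc]].
exists (\sum_(i <- s) c i *: e i) => //.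
by elim: s {sc} => [|i s IH]; rewrite ?big_nil// big_cons; exact: PD.
Qed.

Lemma normc_dot_basis u i : normc (dot u (e i)) ^+ 2 <= sqn u.
Proof.
by have := bessel_fin u be.1 (s := [:: i]) isT; rewrite big_seq1.
Qed.

(** The left side is [sqn (u - p)] for the orthogonal projection [p] of [u] onto the span of the
    [e i] with [i] in [s]. Since [u - p] is orthogonal to [p - q], Pythagoras applies. The list [s]
    may repeat indices, hence [undup]. *)
Lemma bessel_best_approx u (s : seq I) (c : I -> R[i]) :
  sqn u - \sum_(i <- undup s) normc (dot u (e i)) ^+ 2 <=
  sqn (u - \sum_(i <- s) c i *: e i).
Proof.
pose p := \sum_(i <- undup s) dot u (e i) *: e i.
pose q := \sum_(i <- s) c i *: e i; rewrite -/q.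
have us : uniq (undup s) by exact: undup_uniq.
have dpi i : i \in s -> dot p (e i) = dot u (e i).
  rewrite -mem_undup => si; rewrite /p linear_sumlz (bigD1_seq i) //= big1 ?addr0.
    by rewrite linearZl_LR /= be.1 eqxx mulr1.
  by move=> j ji; rewrite linearZl_LR /= be.1 (negbTE ji) mulr0.
have up i : i \in s -> dot (u - p) (e i) = 0.
  by move=> si; rewrite linearBl /= dpi// subrr.
have upq : dot (u - p) q = 0.
  rewrite /q linear_sumr big_seq big1// => i si.
  by rewrite linearZr_LR /= up// mulr0.
have upp : dot (u - p) p = 0.
  rewrite /p linear_sumr big_seq big1// => i; rewrite mem_undup => si.
  by rewrite linearZr_LR /= up// mulr0.
have -> : u - q = (u - p) + (p - q) by rewrite subrKA.
rewrite sqnD linearBr /= upq upp subrr mulr0 addr0.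
suff -> : sqn u - \sum_(i <- undup s) normc (dot u (e i)) ^+ 2 = sqn (u - p).
  by rewrite lerDl sqn_ge0.
have -> : sqn (u - p) = complex.Re (dot u u) - complex.Re (dot p u).
  rewrite {1}/sqnorm linearBr /= upp subr0 linearBl /=.
  by case: (dot u u) (dot p u) => ? ? [].
congr (_ - _); rewrite /p linear_sumlz raddf_sum /=; apply: eq_bigr => i _.
by rewrite linearZl_LR /= [dot (e i) u]dotC mul_conjc_normc.
Qed.

(** Some finite sum of squared coefficients of [u] comes within [eps] of [sqn u], by best
    approximation; the same sum is at most [sqn v], by Bessel. *)
Lemma sqn_le_of_coef u v :
  (forall i, normc (dot u (e i)) = normc (dot v (e i))) -> sqn u <= sqn v.
Proof.
move=> uv; apply/ler_addgt0Pr => eps /(basis_dense u)[s [c sc]].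
have := le_lt_trans (bessel_best_approx u s c) sc.
have := bessel_fin v be.1 (undup_uniq s); rewrite -/(sqn v).
by under eq_bigr do rewrite -uv; lra.
Qed.

Lemma parseval u v :
  (forall i, normc (dot u (e i)) = normc (dot v (e i))) -> sqn u = sqn v.
Proof.
by move=> uv; apply/eqP; rewrite eq_le !sqn_le_of_coef// => i; rewrite uv.
Qed.

(** Parseval compares [u - v] with [0]. *)
Lemma basis_coef_inj u v : (forall i, dot u (e i) = dot v (e i)) -> u = v.
Proof.
move=> uv; apply/eqP; rewrite -subr_eq0; apply/eqP/(sqn_eq0 (dot := dot)).
rewrite (@parseval _ 0) ?/sqnorm ?linear0l// => i.
by rewrite linearBl /= uv subrr linear0l.
Qed.

(** Completeness stated for fast Cauchy sequences only: distances at most [2^-n], squared. The limit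
    keeps the same rate. *)
Definition sqn_complete := forall v : nat -> H,
  (forall n k, sqn (v (n + k)%N - v n) <= 4^-1 ^+ n) ->
  exists u, forall n, sqn (u - v n) <= 4^-1 ^+ n.

(** Explicit on finite combinations of basis vectors. In the limit case, a unimodular multiplier
    preserves distances, so the images of an approximating sequence form a Cauchy sequence, and
    their limit has the required coefficients. *)
Lemma multiplier_exists (m : I -> R[i]) : sqn_complete ->
  (forall i, normc (m i) = 1) ->
  forall u, exists v, forall i, dot v (e i) = m i * dot u (e i).
Proof.
move=> Hcomp m1.
apply: basis_ind => [|a i u [v vE]|u ucl].
- by exists 0 => i; rewrite !linear0l mulr0.
- exists ((m i * a) *: e i + v) => j.
  rewrite !linearDl !linearZl_LR /= vE be.1 mulrDr.
  by have [->|_] := eqVneq i j; rewrite /= ?mulr1 ?mulr0 ?scaler0 ?add0r.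
(* [w.1] approximates [u] and [w.2] is its image. The error [4^-n / 4] is chosen so that two of
   them, doubled by [sqn_dist_le], stay below [4^-n]. *)
have /choice[w wP] : forall n, exists w : H * H,
    (forall i, dot w.2 (e i) = m i * dot w.1 (e i)) /\
    sqn (u - w.1) < 4^-1 ^+ n / 4.
  move=> n; have [|v [v' vv'] uv] := ucl (4^-1 ^+ n / 4).
    by rewrite divr_gt0// exprn_gt0// invr_gt0.
  by exists (v, v').
have [|v vw] := Hcomp (fun n => (w n).2).
  move=> n k; rewrite (@parseval _ ((w (n + k)%N).1 - (w n).1)); last first.
    move=> i; rewrite !linearBl /= (wP n).1 (wP _).1 -mulrBr Normc.normcM.
    by rewrite m1 mul1r.
  rewrite (le_trans (sqn_dist_le _ u _ _))// -(sqnN _ (_ - u)) opprB.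
  have := (wP n).2; have := (wP (n + k)%N).2.
  have : 4^-1 ^+ (n + k) <= 4^-1 ^+ n :> R.
    by apply: ler_wiXn2l; rewrite ?leq_addr// ?invr_ge0// invf_le1// ler1n.
  lra.
exists v => i; apply/eqP; rewrite -subr_eq0; apply/eqP/Normc.eq0_normc.
apply/eqP; rewrite -sqrf_eq0 eq_le sqr_ge0 andbT.
(* The two errors give [2 * (4^-n + 4^-n / 4)], which is below [3 * 4^-n]. *)
apply: (@le0_geometric _ _ 3) => n.
have -> : dot v (e i) - m i * dot u (e i) =
    dot (v - (w n).2) (e i) - m i * dot (u - (w n).1) (e i).
  by rewrite !linearBl /= (wP n).1; ring.
rewrite (le_trans (sqr_normcD_le _ _))// sqr_normcN Normc.normcM m1 mul1r.
have := normc_dot_basis (v - (w n).2) i; have := vw n.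
have := normc_dot_basis (u - (w n).1) i; have := (wP n).2.
have : 0 <= 4^-1 ^+ n :> R by rewrite exprn_ge0// invr_ge0.
lra.
Qed.

End basis.

(** * Completeness of L^2 for a finite measure *)

Section L2_complete.
Local Open Scope complex_scope.
Local Open Scope quotient_scope.
Context d (T : measurableType d) (R : realType).
Variable mu : {measure set T -> \bar R}.
Local Notation normc := Normc.normc.
Local Notation sqn := (sqnorm (@L2_dot d T R mu)).

Definition cmeasurable (f : T -> R[i]) :=
  measurable_fun setT (fun x => complex.Re (f x)) /\
  measurable_fun setT (fun x => complex.Im (f x)).

Lemma cmeasurableB f g : cmeasurable f -> cmeasurable g ->
  cmeasurable (fun x => f x - g x).
Proof.
move=> [fR fI] [gR gI]; split.
- apply: eq_measurable_fun (measurable_funB fR gR) => x _ /=.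
  by case: (f x) (g x) => ? ? [].
- apply: eq_measurable_fun (measurable_funB fI gI) => x _ /=.
  by case: (f x) (g x) => ? ? [].
Qed.

Lemma measurable_sqr_normc f : cmeasurable f ->
  measurable_fun setT (fun x => (normc (f x) ^+ 2)%:E).
Proof.
move=> [fR fI]; apply/measurable_EFinP.
under eq_fun do rewrite sqr_normcE.
by apply: measurable_funD; exact: measurable_funX.
Qed.

Lemma measurable_normc f : cmeasurable f ->
  measurable_fun setT (fun x => (normc (f x))%:E).
Proof.
move=> mf; apply/measurable_EFinP.
have -> : (fun x => normc (f x)) = fun x => (normc (f x) ^+ 2) `^ 2^-1.
  apply/funext => x; rewrite powR12_sqrt ?sqr_ge0// sqrtr_sqr ger0_norm//.
  by case: (f x) => a b; exact: sqrtr_ge0.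
apply: (measurableT_comp (measurable_powR _)).
by apply/measurable_EFinP; exact: measurable_sqr_normc.
Qed.

Lemma L2fun_cmeasurable (f : L2fun mu) : cmeasurable f.
Proof. by have := valP f; rewrite inE => -[]. Qed.

Lemma square_integrableP f : cmeasurable f ->
  (\int[mu]_x (normc (f x) ^+ 2)%:E < +oo)%E -> f \in square_integrable mu.
Proof.
move=> [fR fI] foo; rewrite inE; split => //.
rewrite /finite_norm unlock poweR_lty//; apply: le_lt_trans foo.
rewrite le_eqVlt; apply/orP; left; apply/eqP; apply: eq_integral => x _ /=.
by rewrite powR_mulrn// real_normK// num_real.
Qed.

Lemma sqn_L2E (f : L2fun mu) :
  (sqn (\pi_(L2 mu) f))%:E = (\int[mu]_x (normc (f x) ^+ 2)%:E)%E.
Proof.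
have [iR _] := L2fun_cintegrable f f.
have E x : (normc (f x) ^+ 2)%:E =
    (EFin \o (fun x => complex.Re (f x * (f x)^*))) x.
  by rewrite /comp mul_conjc_normc.
under eq_integral do rewrite E.
rewrite (_ : sqn _ =
  complex.Re (L2_dot (\pi_(L2 mu) f) (\pi_(L2 mu) f)))// L2_dotE.
by rewrite /= fineK//; exact: integrable_fin_num iR.
Qed.

Lemma L2_piB (f g : L2fun mu) :
  \pi_(L2 mu) f - \pi_(L2 mu) g = \pi_(L2 mu) (f - g).
Proof.
rewrite -[LHS]/(L2_add _ (L2_opp _)) L2_oppE L2_addE.
by [].
Qed.

Lemma sqn_L2B (u v : L2 mu) :
  (sqn (u - v))%:E = (\int[mu]_x (normc (u x - v x) ^+ 2)%:E)%E.
Proof.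
rewrite [u - v](_ : _ = \pi_(L2 mu) (repr u - repr v)) ?sqn_L2E//.
by rewrite -L2_piB !reprK.
Qed.

Lemma limn_einf_le (u : (\bar R)^nat) (c : \bar R) :
  (forall n, (u n <= c)%E) -> (limn_einf u <= c)%E.
Proof.
move=> uc; rewrite limn_einf_lim; apply: lime_le; first exact: is_cvg_einfs.
apply: nearW => n; apply: le_trans (uc n).
by apply: ereal_inf_lbound; exists n => /=.
Qed.

Lemma measurable_limn_einf (f : (T -> \bar R)^nat) :
  (forall n, measurable_fun setT (f n)) ->
  measurable_fun setT (fun x => limn_einf (f^~ x)).
Proof.
move=> mf; under eq_fun do rewrite -[limn_einf _]oppeK -limn_esupN.
apply: measurableT_comp => //; apply: measurable_fun_limn_esup => n.
exact: measurableT_comp.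
Qed.

Hypothesis muoo : (mu setT < +oo)%E.

(** On a finite measure space the L^2 bounds [2^-n] give geometric L^1 bounds, so the sum of the
    [h n] is integrable and therefore finite almost everywhere. *)
Lemma ae_summable (h : nat -> T -> R) : (forall n x, 0 <= h n x) ->
  (forall n, measurable_fun setT (h n)) ->
  (forall n, (\int[mu]_x (h n x ^+ 2)%:E <= (4^-1 ^+ n)%:E)%E) ->
  {ae mu, forall x, cvgn (series (h^~ x))}.
Proof.
move=> h0 mh hint.
have mEh n : measurable_fun setT (EFin \o h n) by exact/measurable_EFinP.
have ih n : (\int[mu]_x (h n x)%:E <= ((fine (mu setT) + 1) * 2^-1 ^+ n)%:E)%E.
  have mh2 : measurable_fun setT (fun x => (h n x ^+ 2)%:E).
    by apply/measurable_EFinP; exact: measurable_funX.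
  (* [h <= 2^-n + 2^n h^2] stands in for the Cauchy-Schwarz inequality. *)
  apply: (@le_trans _ _ (\int[mu]_x
      ((2^-1 ^+ n)%:E + (2 ^+ n)%:E * (h n x ^+ 2)%:E))%E).
    apply: ge0_le_integral => //.
    - by move=> x _; rewrite lee_fin.
    - exact: mEh.
    - by apply: emeasurable_funD => //; exact: measurable_funeM.
    move=> x _; rewrite -EFinM -EFinD lee_fin.
    have := sqr_ge0 (2^-1 ^+ n - h n x); have := h0 n x.
    have p0 : 0 < 2^-1 ^+ n :> R by rewrite exprn_gt0// invr_gt0.
    have -> : 2 ^+ n = (2^-1 ^+ n)^-1 :> R by rewrite -exprVn invrK.
    (* With [p = 2^-n], multiplying by [p] leaves [p * h <= p^2 + h^2], which follows from
       [(p - h)^2 >= 0]. *)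
    rewrite -(ler_pM2l p0) mulrDr mulVKf ?gt_eqF//; nra.
  rewrite ge0_integralD//=; last 2 first.
  - by move=> x _; rewrite -EFinM lee_fin mulr_ge0 ?exprn_ge0 ?h0.
  - exact: measurable_funeM.
  rewrite integral_cst// ge0_integralZl_EFin ?exprn_ge0//; last first.
    by move=> x _; rewrite lee_fin sqr_ge0.
  rewrite mulrDl mul1r EFinD; apply: leeD.
    by rewrite -[X in (_ * X)%E]fineK ?ge0_fin_numE// -EFinM mulrC.
  apply: (@le_trans _ _ ((2 ^+ n)%:E * (4^-1 ^+ n)%:E)%E).
    by apply: lee_wpmul2l => //; rewrite lee_fin exprn_ge0.
  by rewrite -EFinM -exprMn lee_fin [2 * 4^-1](_ : _ = 2^-1)//; field.
have iS : mu.-integrable setT (fun x => \sum_(n <oo) (h n x)%:E)%E.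
  apply/integrableP; split.
    apply: ge0_emeasurable_sum => [n x _ _|n _]; last exact: mEh.
    by rewrite lee_fin.
  under eq_integral.
    move=> x _; rewrite gee0_abs; last first.
      by apply: nneseries_ge0 => n _ _; rewrite lee_fin.
    over.
  rewrite integral_nneseries//; last by move=> n x _; rewrite lee_fin.
  apply: (@le_lt_trans _ _ ((fine (mu setT) + 1) * (1 - 2^-1)^-1)%:E);
    last exact: ltry.
  apply: lime_le.
    by apply: is_cvg_nneseries => n _ _; apply: integral_ge0 => x _;
      rewrite lee_fin.
  apply: nearW => n; apply: (@le_trans _ _
      (\sum_(0 <= k < n) ((fine (mu setT) + 1) * 2^-1 ^+ k)%:E)%E).
    by apply: lee_sum => k _; exact: ih.
  rewrite sumEFin lee_fin; apply: (@geometric_le_lim R n _ 2^-1).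
  - by rewrite addr_ge0// fine_ge0.
  - by rewrite invr_gt0.
  - by rewrite ger0_norm ?invr_ge0// invf_lt1// ltr1n.
apply: filterS (integrable_ae measurableT iS) => x /(_ I) xfin.
apply: nnseries_is_cvg => //; rewrite -ge0_fin_numE//.
by apply: nneseries_ge0 => n _ _; rewrite lee_fin.
Qed.

(** The telescoping series of [a] converges absolutely by comparison with [h]. The limit is written
    as an upper limit because that is measurable in a parameter whether or not the sequence
    converges. *)
Lemma cvg_fine_limn_esup (a h : nat -> R) :
  (forall n, `|a n.+1 - a n| <= h n) -> cvgn (series h) ->
  a n @[n --> \oo] --> fine (limn_esup (EFin \o a)).
Proof.
move=> ah ch.
have ca : cvgn a.
  rewrite (_ : a = fun n => a 0%N + series (telescope a) n); last first.
    by apply/funext => n; rewrite -eq_sum_telescope.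
  apply: is_cvgD; first exact: is_cvg_cst.
  apply: normed_cvg; apply: series_le_cvg ch => n.
  - exact: normr_ge0.
  - exact: le_trans (ah n).
  - exact: ah.
rewrite is_cvg_limn_esupE; last first.
  apply/cvg_ex; exists (limn a)%:E; apply: cvg_EFin; last exact: ca.
  exact: nearW.
by rewrite EFin_lim.
Qed.

(** Riesz-Fischer: the increments are summable almost everywhere, which yields a pointwise limit
    [F], and Fatou's lemma carries the bound on [v (n + k) - v n] over to [F - v n]. *)
Lemma L2_sqn_complete : sqn_complete (@L2_dot d T R mu).
Proof.
move=> v vC; pose f n := L2_to_fun (v n : L2 mu).
have mf n : cmeasurable (f n) by exact: L2fun_cmeasurable.
(* Where the sequence diverges the value is arbitrary; only measurability matters there. *)
pose F x : R[i] := fine (limn_esup (fun n => (complex.Re (f n x))%:E)) +i*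
  fine (limn_esup (fun n => (complex.Im (f n x))%:E)).
have mF : cmeasurable F.
  by split; apply: measurableT_comp => //; apply: measurable_fun_limn_esup => n;
    apply/measurable_EFinP; have [] := mf n.
have nle (z : R[i]) : `|complex.Re z| <= normc z /\ `|complex.Im z| <= normc z.
  case: z => a b /=; rewrite -!sqrtr_sqr; split.
  - by rewrite ler_wsqrtr// lerDl sqr_ge0.
  - by rewrite ler_wsqrtr// lerDr sqr_ge0.
have fF : {ae mu, forall x,
    complex.Re (f n x) @[n --> \oo] --> complex.Re (F x) /\
    complex.Im (f n x) @[n --> \oo] --> complex.Im (F x)}.
  have : {ae mu, forall x, cvgn (series (fun n => normc (f n.+1 x - f n x)))}.
    apply: ae_summable.
    - by move=> n x; case: (_ - _) => a b; exact: sqrtr_ge0.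
    - move=> n; apply/measurable_EFinP.
      by apply: measurable_normc; exact: cmeasurableB.
    - by move=> n; rewrite -sqn_L2B lee_fin; have := vC n 1%N; rewrite addn1.
  apply: filterS => x cx; split.
  - apply: cvg_fine_limn_esup cx => n.
    by have [+ _] := nle (f n.+1 x - f n x); case: (f n.+1 x) (f n x) => ? ? [].
  - apply: cvg_fine_limn_esup cx => n.
    by have [_ +] := nle (f n.+1 x - f n x); case: (f n.+1 x) (f n x) => ? ? [].
have bound n : (\int[mu]_x (normc (F x - f n x) ^+ 2)%:E <= (4^-1 ^+ n)%:E)%E.
  pose g k x := (normc (f (n + k)%N x - f n x) ^+ 2)%:E.
  have mg k : measurable_fun setT (g k).
    by apply: measurable_sqr_normc; exact: cmeasurableB.
  have g0 k x : setT x -> (0 <= g k x)%E by move=> _; rewrite lee_fin sqr_ge0.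
  rewrite (_ : (\int[mu]_x _)%E = (\int[mu]_x limn_einf (g^~ x))%E).
    apply: (le_trans (fatou mu measurableT mg g0)); apply: limn_einf_le => k.
    by rewrite -sqn_L2B lee_fin.
  apply: ge0_ae_eq_integral => //.
  - by apply: measurable_sqr_normc; exact: cmeasurableB.
  - exact: measurable_limn_einf.
  - by move=> x _; rewrite lee_fin sqr_ge0.
  - move=> x _; rewrite limn_einf_lim; apply: lime_ge; first exact: is_cvg_einfs.
    by apply: nearW => k; apply: le_ereal_inf_tmp => _ [j _ <-]; exact: g0.
  apply: filterS fF => x [xR xI] _; apply/esym.
  suff gx : g^~ x @ \oo --> (normc (F x - f n x) ^+ 2)%:E.
    rewrite is_cvg_limn_einfE; first exact/cvg_lim.
    by apply/cvg_ex; eexists; exact: gx.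
  apply: cvg_EFin; first by apply: nearW.
  have E (z w : R[i]) : normc (z - w) ^+ 2 =
      (complex.Re z - complex.Re w) ^+ 2 + (complex.Im z - complex.Im w) ^+ 2.
    by rewrite sqr_normcE; case: z w => ? ? [].
  rewrite E (_ : fine \o _ = fun k =>
    (complex.Re (f (n + k)%N x) - complex.Re (f n x)) ^+ 2 +
    (complex.Im (f (n + k)%N x) - complex.Im (f n x)) ^+ 2); last first.
    by apply/funext => k; exact: E.
  have sq (a : nat -> R) l c : a n @[n --> \oo] --> l ->
      (a (n + k)%N - c) ^+ 2 @[k --> \oo] --> (l - c) ^+ 2.
    move=> al; rewrite expr2; under eq_fun do rewrite expr2 addnC.
    suff : a (k + n)%N - c @[k --> \oo] --> l - c by move=> ac; exact: cvgM.
    by apply: cvgB; [rewrite (cvg_shiftn n a)|exact: cvg_cst].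
  by apply: cvgD; [exact: (sq (fun n => complex.Re (f n x)))|
                   exact: (sq (fun n => complex.Im (f n x)))].
(* Square integrability of [F] comes from that of [F - f 0], the bound at [n = 0], by adding [f 0]
   back. *)
have D0 : (fun x => F x - f 0%N x) \in square_integrable mu.
  apply: square_integrableP; first exact: cmeasurableB.
  exact: le_lt_trans (bound 0%N) (ltry _).
pose G : L2fun mu := MkL2fun D0 + repr (v 0%N).
have GE x : G x = F x by exact: subrK.
exists (\pi_(L2 mu) G) => n; rewrite -lee_fin -[v n]reprK L2_piB sqn_L2E.
apply: le_trans (bound n); rewrite le_eqVlt; apply/orP; left; apply/eqP.
by apply: eq_integral => x _; rewrite -GE.
Qed.

End L2_complete.

(** * Diagonal multipliers form a strongly continuous unitary group *)

Section multiplier_group.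
Context (R : realType) (H : lmodType R[i]) (dot : {dot H for conjc}).
Context (I : eqType) (e : I -> H) (be : orthonormal_basis dot e).
Variables (m : R -> I -> R[i]) (U : R -> H -> H).
Local Notation sqn := (sqnorm dot).
Local Notation normc := Normc.normc.
Hypothesis m1 : forall t i, normc (m t i) = 1.
Hypothesis m0 : forall i, m 0 i = 1.
Hypothesis mD : forall s t i, m (s + t) i = m s i * m t i.
Hypothesis mcont : forall i t (eps : R), 0 < eps ->
  \forall s \near t, normc (m s i - m t i) ^+ 2 < eps.
Hypothesis UE : forall t u i, dot (U t u) (e i) = m t i * dot u (e i).

(** [U] is known only through its coefficients, but these determine a vector; the algebraic laws
    below are checked in the same way. *)
Lemma multiplier_linear t : linear (U t).
Proof.
move=> a u v; apply: (basis_coef_inj be) => i.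
rewrite UE !linearDl !linearZl_LR /= !UE mulrDr.
by congr (_ + _); exact: mulrCA.
Qed.

Lemma multiplier_sqn t u : sqn (U t u) = sqn u.
Proof. by apply: (parseval be) => i; rewrite UE Normc.normcM m1 mul1r. Qed.

Lemma multiplierD s t u : U (s + t) u = U s (U t u).
Proof. by apply: (basis_coef_inj be) => i; rewrite !UE mD mulrA. Qed.

Lemma multiplier0 u : U 0 u = u.
Proof. by apply: (basis_coef_inj be) => i; rewrite !UE m0 mul1r. Qed.

Lemma multiplier_basis t i : U t (e i) = m t i *: e i.
Proof.
apply: (basis_coef_inj be) => j; rewrite UE linearZl_LR /= be.1.
by have [->//|_] := eqVneq i j; rewrite !mulr0.
Qed.

Lemma multiplier_unitary t : unitary_operator dot (U t).
Proof.
split; first exact: multiplier_linear.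
- by apply: linear_sqn_dot; [exact: multiplier_linear|exact: multiplier_sqn].
- exists (U (- t)) => u; rewrite -multiplierD.
  + by rewrite addNr multiplier0.
  + by rewrite subrr multiplier0.
Qed.

(** On basis vectors this is continuity of [m] in time. It passes to limits because the operators
    are isometries, which makes the approximation error uniform in [s]. *)
Lemma multiplier_near_sqn u t (eps : R) : 0 < eps ->
  \forall s \near t, sqn (U s u - U t u) < eps.
Proof.
move: u t eps.
have UDZ s a v w : U s (a *: v + w) = a *: U s v + U s w.
  exact: multiplier_linear.
have UB s v w : U s (v - w) = U s v - U s w.
  by rewrite -scaleN1r addrC UDZ scaleN1r addrC.
apply: (basis_ind be) => [t eps e0|a i u IH t eps e0|u ucl t eps e0].
- have U0 s : U s 0 = 0 by have := UB s 0 0; rewrite !subrr.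
  by near=> s; rewrite !U0 subr0 /sqnorm linear0l.
(* Makes the basis term at most [eps / 4], as is the other term, before doubling by [sqnD_le]; the
   summand [1] keeps [c] positive when [a = 0]. *)
- pose c := 4 * (normc a ^+ 2 + 1).
  have c0 : 0 < c.
    apply: mulr_gt0 => //; apply: ltr_wpDl => //; exact: sqr_ge0.
  have h1 := mcont i t (divr_gt0 e0 c0).
  have h2 := IH t (eps / 4) (divr_gt0 e0 (ltr0Sn _ 3)).
  near=> s.
  have -> : U s (a *: e i + u) - U t (a *: e i + u) =
      (a * (m s i - m t i)) *: e i + (U s u - U t u).
    rewrite !UDZ !multiplier_basis !scalerA mulrBr scalerBl opprD addrACA.
    by [].
  rewrite (le_lt_trans (sqnD_le _ _ _))// sqnZ /sqnorm be.1 eqxx /= mulr1.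
  rewrite Normc.normcM exprMn.
  have s1 : normc (m s i - m t i) ^+ 2 < eps / c by near: s.
  have s2 : sqn (U s u - U t u) < eps / 4 by near: s.
  have : normc a ^+ 2 * normc (m s i - m t i) ^+ 2 <= eps / 4.
    apply: (@le_trans _ _ ((normc a ^+ 2 + 1) * (eps / c))).
      apply: ler_pM; rewrite ?sqr_ge0 ?lerDl//; exact: ltW.
    rewrite /c le_eqVlt; apply/orP; left; apply/eqP; field.
    by rewrite gt_eqF// ltr_wpDl// sqr_ge0.
  move: s2; rewrite /sqnorm; lra.
(* By isometry the term in [u - v] is at most [4 * sqn (u - v)], hence below [eps / 4]. *)
- have [v IH uv] := ucl (eps / 16) (divr_gt0 e0 (ltr0Sn _ 15)).
  have h2 := IH t (eps / 4) (divr_gt0 e0 (ltr0Sn _ 3)).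
  near=> s.
  have -> : U s u - U t u = (U s (u - v) - U t (u - v)) + (U s v - U t v).
    by rewrite !UB opprB [X in _ = X]addrACA subrK [_ - _ - _]addrAC subrr sub0r.
  rewrite (le_lt_trans (sqnD_le _ _ _))//.
  have := sqnB_le dot (U s (u - v)) (U t (u - v)); rewrite !multiplier_sqn.
  have : sqn (U s v - U t v) < eps / 4 by near: s.
  lra.
Unshelve. all: by end_near. Qed.

Lemma multiplier_group : strongly_continuous_unitary_group dot U.
Proof.
split; [exact: multiplier_unitary|exact: multiplier0|exact: multiplierD|].
move=> u t; apply/cvgr0Pnorm_lt => eps e0.
have := multiplier_near_sqn u t (exprn_gt0 2 e0).
apply: filterS => s; rewrite -hnorm_lt// => h.
by rewrite ger0_norm// sqrtr_ge0.
Qed.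

End multiplier_group.

(** * Translation invariance of Lebesgue measure and integral *)

Section lebesgue_translation.
Context (R : realType).
Local Notation leb := (@lebesgue_measure R).
Local Notation shift t := 
  ((fun x => x + t) : measurableTypeR R -> measurableTypeR R).

Lemma measurable_shift t : measurable_fun setT (shift t).
Proof. exact: measurable_funD. Qed.

(** The push-forward under the shift agrees with Lebesgue measure on half-open intervals, and these
    determine it. *)
Lemma lebesgue_measure_shift t (A : set (measurableTypeR R)) :
  measurable A -> leb (shift t @^-1` A) = leb A.
Proof.
move=> mA; rewrite -[LHS]/(pushforward leb (shift t) A).
apply/esym/(lebesgue_measure_unique (mu := pushforward leb (shift t))) => //=.
  exact: measurable_shift.
- move=> _ _ [[a b]] _ <-; rewrite /pushforward.
  rewrite (_ : _ @^-1` _ = `]a - t, b - t]%classic); last first.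
    by apply/seteqP; split=> x /=; rewrite !in_itv /= ltrBlDr lerBrDr.
  by rewrite !lebesgue_measure_itv/= !lte_fin ltrD2r -!EFinB opprB addrA subrK.
Qed.

Lemma ae_lebesgueS (P Q : R -> Prop) : (forall x, P x -> Q x) ->
  {ae leb, forall x, P x} -> {ae leb, forall x, Q x}.
Proof. 
by move=> PQ; exact: (@filterS _ _ (ae_filter_ringOfSetsType leb) _ _ PQ).
Qed.

Lemma ae_lebesgueI (P Q : R -> Prop) : {ae leb, forall x, P x} ->
  {ae leb, forall x, Q x} -> {ae leb, forall x, P x /\ Q x}.
Proof. exact: (@filterI _ _ (ae_filter_ringOfSetsType leb)). Qed.

Lemma ae_lebesgue_shift t (P : R -> Prop) :
  {ae leb, forall x, P x} -> {ae leb, forall x, P (x + t)}.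
Proof.
move=> [N [mN N0 PN]]; exists (shift t @^-1` N); split.
- by rewrite -[X in measurable X]setTI; exact: measurable_shift.
- by rewrite -[RHS]N0; exact: lebesgue_measure_shift.
- by move=> x /= nP; exact: (PN (x + t)).
Qed.

Lemma ge0_integral_lebesgue_shift t (D : set (measurableTypeR R))
  (h : R -> \bar R) :
  measurable D -> measurable_fun setT (h : measurableTypeR R -> \bar R) ->
  (forall x, 0 <= h x)%E ->
  (\int[leb]_(x in shift t @^-1` D) h (x + t)%R = \int[leb]_(x in D) h x)%E.
Proof.
move=> mD mh h0.
have := ge0_integral_pushforward (measurable_shift t) leb mD
  (measurable_funTS mh) (fun y _ => h0 y).
move=> <-; apply: eq_measure_integral; first exact: measurable_shift.
by move=> mt A mA _; exact: lebesgue_measure_shift.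
Qed.

Lemma ae_mrestr (Omega : set (measurableTypeR R)) (mOmega : measurable Omega)
  (P : R -> Prop) : {ae mrestr leb mOmega, forall x, P x} ->
  {ae leb, forall x, Omega x -> P x}.
Proof.
move=> [N [mN N0 PN]]; exists (N `&` Omega); split => //.
- exact: measurableI.
- move=> x /= /not_implyP[Ox nP]; split=> //; exact: PN.
Qed.

Lemma integral_mrestr (Omega S : set (measurableTypeR R))
  (mOmega : measurable Omega) (h : R -> \bar R) : S `<=` Omega ->
  (\int[mrestr leb mOmega]_(x in S) h x = \int[leb]_(x in S) h x)%E.
Proof.
move=> SO; apply: eq_measure_integral => A mA AS.
by rewrite /= /mrestr; congr leb; apply/setIidPl; exact: subset_trans SO.
Qed.

End lebesgue_translation.

(** * Exponentials as continuous characters *)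

Section exponential_facts.
Context (R : realType).
Implicit Types l s t : R.

Lemma expo0 l : expo l 0 = 1.
Proof. by rewrite /expo mulr0 cos0 sin0. Qed.

Lemma expoD l s t : expo l (s + t) = expo l s * expo l t.
Proof.
rewrite /expo mulrDr cosD sinD; apply/eqP; rewrite eq_complex /= eqxx /=.
by rewrite [X in _ == X]addrC; apply/eqP; congr (_ + _); exact: mulrC.
Qed.

Lemma near_expo l t (eps : R) : 0 < eps ->
  \forall s \near t, Normc.normc (expo l s - expo l t) ^+ 2 < eps.
Proof.
move=> e0; set k := 2 * pi * l.
have ks : k * s @[s --> t] --> k * t by apply: cvgMr; exact: cvg_id.
have cs : cos (k * s) - cos (k * t) @[s --> t] --> (0 : R).
  rewrite -(subrr (cos (k * t))); apply: cvgB; last exact: cvg_cst.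
  exact: (cvg_comp _ _ ks (@continuous_cos R _)).
have sn : sin (k * s) - sin (k * t) @[s --> t] --> (0 : R).
  rewrite -(subrr (sin (k * t))); apply: cvgB; last exact: cvg_cst.
  exact: (cvg_comp _ _ ks (@continuous_sin R _)).
have : (cos (k * s) - cos (k * t)) * (cos (k * s) - cos (k * t)) +
  (sin (k * s) - sin (k * t)) * (sin (k * s) - sin (k * t))
    @[s --> t] --> (0 : R).
  by rewrite -[X in _ --> X](addr0 0) -{1 2}(mulr0 0); apply: cvgD; exact: cvgM.
move/cvgr0Pnorm_lt => /(_ _ e0); apply: filterS => s.
have p (x : R) : 0 <= x * x by rewrite -expr2 sqr_ge0.
by rewrite sqr_normcE /= -/k !expr2 ger0_norm// addr_ge0 ?p.
Qed.

End exponential_facts.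

(** * The local translation property is closed under L^2 limits *)

Section spectral_translation.
Local Open Scope complex_scope.
Local Open Scope quotient_scope.
Context (R : realType) (Omega : set (measurableTypeR R)).
Variable mOmega : measurable Omega.
Local Notation leb := (@lebesgue_measure R).
Local Notation mu := (mrestr leb mOmega).
Local Notation dot := (L2on_dot mOmega).
Local Notation sqn := (sqnorm dot).
Local Notation normc := Normc.normc.
Local Notation shift t := 
  ((fun x => x + t) : measurableTypeR R -> measurableTypeR R).
Implicit Types f g : L2on mOmega.

(** Each class has its own chosen representative, so evaluation at points is linear only almost
    everywhere. *)
Lemma ae_L2on_linear a f g :
  {ae leb, forall x, Omega x -> (a *: f + g : L2on mOmega) x = a * f x + g x}.
Proof.
apply: (ae_mrestr (mOmega := mOmega)).
have -> : a *: f + g = \pi_(L2on mOmega) (a *: repr f + repr g).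
  by rewrite -L2_addE -L2_scaleE !reprK.
apply: filterS (L2_reprK (a *: repr f + repr g)) => x /(_ I) h. exact: h.
Qed.

Lemma ae_L2on0 : {ae leb, forall x, Omega x -> (0 : L2on mOmega) x = 0}.
Proof.
apply: (ae_mrestr (mOmega := mOmega)).
by apply: filterS (L2_reprK (0 : L2fun mu)) => x /(_ I) h; exact: h.
Qed.

Lemma cmeasurable_shift t (h : R -> R[i]) :
  cmeasurable (h : measurableTypeR R -> _) ->
  cmeasurable ((fun x => h (x + t)) : measurableTypeR R -> _).
Proof.
move=> [hR hI]; split.
- exact: (measurableT_comp hR (measurable_shift t)).
- exact: (measurableT_comp hI (measurable_shift t)).
Qed.

Let n2 f g (x : R) := (normc (f x - g x) ^+ 2)%:E.

Let n2_ge0 f g x : (0 <= n2 f g x)%E. Proof. by rewrite lee_fin sqr_ge0. Qed.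

Let measurable_n2 f g : measurable_fun setT (n2 f g : measurableTypeR R -> _).
Proof.
by apply: measurable_sqr_normc; apply: cmeasurableB; exact: L2fun_cmeasurable.
Qed.

Lemma integral_le_sqn f g (S : set (measurableTypeR R)) : measurable S ->
  S `<=` Omega ->
  (\int[leb]_(x in S) (normc (f x - g x) ^+ 2)%:E <= (sqn (f - g))%:E)%E.
Proof.
move=> mS SO; rewrite -(integral_mrestr mOmega _ SO) sqn_L2B.
apply: ge0_subset_integral => //; first exact: measurable_n2.
by move=> x _; exact: n2_ge0.
Qed.

(** Substituting [x + t] turns the integral over the whole preimage of [Omega] into the one over
    [Omega]. *)
Lemma integral_shift_le_sqn f g t (S : set (measurableTypeR R)) :
  measurable S -> S `<=` shift t @^-1` Omega ->
  (\int[leb]_(x in S) (normc (f (x + t)%R - g (x + t)%R) ^+ 2)%:E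
     <= (sqn (f - g))%:E)%E.
Proof.
move=> mS SO; apply: le_trans (integral_le_sqn f g mOmega (@subset_refl _ _)).
rewrite -[leRHS](ge0_integral_lebesgue_shift t mOmega (@measurable_n2 f g))//.
have mO : measurable (shift t @^-1` Omega).
  by rewrite -[X in measurable X]setTI; exact: measurable_shift.
apply: ge0_subset_integral => //; last by move=> x _; exact: n2_ge0.
apply: measurable_funTS; apply: measurable_sqr_normc.
by apply: cmeasurableB; apply: cmeasurable_shift; exact: L2fun_cmeasurable.
Qed.

Variables (U : L2on mOmega -> L2on mOmega) (t : R).
Hypothesis UB : forall f g, sqn (U f - U g) = sqn (f - g).

Definition translates f :=
  {ae leb, forall x : R, Omega x -> Omega (x + t) -> U f x = f (x + t)}.

(** On [S], an approximant [v] that is translated exactly splits [U f - f(. + t)] into [U f - U v]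
    and [v(. + t) - f(. + t)]. Both have squared norm on [S] at most [sqn (f - v)], so the integral
    of the squared defect is zero. *)
Lemma translates_closed f :
  (forall eps : R, 0 < eps -> exists2 g, translates g & sqn (f - g) < eps) ->
  translates f.
Proof.
move=> fcl; pose S : set (measurableTypeR R) := Omega `&` shift t @^-1` Omega.
have mS : measurable S.
  apply: measurableI => //.
  by rewrite -[X in measurable X]setTI; exact: measurable_shift.
pose g x := (normc (U f x - f (x + t)) ^+ 2)%:E.
have mg : measurable_fun setT (g : measurableTypeR R -> _).
  apply: measurable_sqr_normc; apply: cmeasurableB.
    exact: L2fun_cmeasurable.
  by apply: cmeasurable_shift; exact: L2fun_cmeasurable.
have g0 x : (0 <= g x)%E by rewrite lee_fin sqr_ge0.
have intg : (\int[leb]_(x in S) g x = 0)%E.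
  apply/eqP; rewrite eq_le integral_ge0// andbT.
  apply/lee_addgt0Pr => eps e0; rewrite add0e.
  (* The final bound is [2 * (sqn (f - v) + sqn (f - v))], hence the quarter. *)
  have [v Tv fv] := fcl (eps / 4) (divr_gt0 e0 (ltr0Sn _ 3)).
  pose a x := n2 (U f) (U v) x; pose b x := n2 f v (x + t).
  have ma : measurable_fun setT (a : measurableTypeR R -> _).
    exact: measurable_n2.
  have mb : measurable_fun setT (b : measurableTypeR R -> _).
    apply: measurable_sqr_normc.
    by apply: cmeasurableB; apply: cmeasurable_shift; exact: L2fun_cmeasurable.
  apply: (@le_trans _ _ (\int[leb]_(x in S) (2%:E * (a x + b x)))%E).
    apply: ae_ge0_le_integral => //.
    - exact: measurable_funTS.
    - by move=> x _; rewrite mule_ge0// adde_ge0// n2_ge0.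
    - apply: measurable_funTS; apply: measurable_funeM.
      exact: emeasurable_funD.
    move: Tv; apply: ae_lebesgueS => x Tv [Ox Oxt].
    rewrite /g /a /b /n2 -EFinD -EFinM lee_fin.
    have -> : U f x - f (x + t) = (U f x - U v x) - (f (x + t) - v (x + t)).
      by rewrite Tv// opprB addrA subrK.
    by rewrite (le_trans (sqr_normcD_le _ _))// sqr_normcN.
  rewrite ge0_integralZl//; last 2 first.
  - by apply: measurable_funTS; exact: emeasurable_funD.
  - by move=> x _; rewrite adde_ge0// n2_ge0.
  rewrite ge0_integralD//; last 4 first.
  - by move=> x _; exact: n2_ge0.
  - exact: measurable_funTS.
  - by move=> x _; exact: n2_ge0.
  - exact: measurable_funTS.
  have := integral_le_sqn (U f) (U v) mS (@subIsetl _ _ _).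
  have := integral_shift_le_sqn f v mS (@subIsetr _ _ _).
  rewrite UB => Ib Ia.
  apply: (@le_trans _ _ (2%:E * ((sqn (f - v))%:E + (sqn (f - v))%:E))%E).
    by apply: lee_wpmul2l => //; exact: leeD.
  by rewrite -EFinD -EFinM lee_fin; lra.
have : (\int[leb]_(x in S) `|g x| = 0)%E.
  by rewrite -[RHS]intg; apply: eq_integral => x _; rewrite gee0_abs.
move/(ae_eq_integral_abs leb mS (measurable_funTS mg)).
apply: ae_lebesgueS => x gx Ox Oxt; have [] := gx (conj Ox Oxt).
move/eqP; rewrite sqrf_eq0 => /eqP/Normc.eq0_normc/eqP.
by rewrite subr_eq0 => /eqP.
Qed.

End spectral_translation.

(** * The group associated to a spectrum *)

Section associated_group_facts.
Local Open Scope complex_scope.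
Local Open Scope quotient_scope.
Context (R : realType) (Omega : set (measurableTypeR R)).
Variables (mOmega : measurable Omega) (Lambda : set R).
Hypothesis spec : is_spectrum mOmega Lambda.
Local Notation leb := (@lebesgue_measure R).
Local Notation mu := (mrestr leb mOmega).
Local Notation dot := (L2on_dot mOmega).
Local Notation e l := (normalized_expo mOmega (val l)).

Let muoo : (mu setT < +oo)%E.
Proof. by rewrite /= /mrestr setTI; exact: spec.1. Qed.

(** [fourier_inv] is a right inverse of [fourier] only on the range of the latter; the vector [g]
    shows that the modulated coefficients lie there. *)
Lemma dot_associated_group t f (l : Lambda) :
  dot (associated_group spec t f) (e l) = expo (val l) t * dot f (e l).
Proof.
have [g gE] : exists g, forall l : Lambda,
    dot g (e l) = expo (val l) t * dot f (e l).
  apply: (multiplier_exists spec.2 (m := fun l => expo (val l) t)).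
  - exact: L2_sqn_complete.
  - by move=> l'; exact: normc_expo.
have Fg : fourier spec g = Uhat t (fourier spec f).
  by apply/val_inj/funext => l' /=; exact: gE.
have FU : fourier spec (associated_group spec t f) = Uhat t (fourier spec f).
  by rewrite /associated_group /fourier_inv pinvK// inE; exists g.
by have := congr1 (fun a : ell2 R Lambda => a l) FU.
Qed.

(** Finite measure makes the exponential square integrable, so [to_L2] does not return its default
    value. *)
Lemma ae_normalized_expo (l : R) :
  {ae leb, forall x, Omega x -> normalized_expo mOmega l x =
     ((Num.sqrt (fine (leb Omega)))^-1)%:C * expo l x}.
Proof.
apply: (ae_mrestr (mOmega := mOmega)).
rewrite /normalized_expo /to_L2 -[_ *: _]/(L2_scale _ _) L2_scaleE.
have E := insubdK (0 : L2fun mu) (expo_square_integrable l muoo).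
apply: filterS (L2_reprK (((Num.sqrt (fine (leb Omega)))^-1)%:C *:
  (insubd (0 : L2fun mu) (expo l)))) => x /(_ I) h.
by rewrite [LHS]h -[in RHS]E.
Qed.

Lemma associated_group_translates t f :
  translates (associated_group spec t) t f.
Proof.
pose m (s : R) (l : Lambda) := expo (val l) s.
have mg s u l : dot (associated_group spec s u) (e l) = m s l * dot u (e l).
  exact: dot_associated_group.
have Ulin : linear (associated_group spec t).
  exact: (multiplier_linear spec.2 mg).
have U0 : associated_group spec t 0 = 0.
  apply: (basis_coef_inj spec.2) => l.
  by rewrite mg !linear0l mulr0.
move: f; apply: (basis_ind spec.2) => [|a l f Tf|f fcl].
(* Even the zero class has a representative vanishing only almost everywhere on [Omega]; it is
   evaluated both at [x] and at [x + t]. *)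
- have h0 := ae_L2on0 mOmega.
  apply: ae_lebesgueS (ae_lebesgueI h0 (ae_lebesgue_shift t h0)).
  move=> x [h h'] Ox Oxt.
  by rewrite U0 h// h'.
(* The operator multiplies [e l] by [expo l t], and [expo l t * expo l x = expo l (x + t)]:
   translation is exact on this summand. *)
- have hf := ae_L2on_linear a (e l) f.
  have hU := ae_L2on_linear (a * expo (val l) t) (e l)
    (associated_group spec t f).
  have he := ae_normalized_expo (val l).
  apply: ae_lebesgueS (ae_lebesgueI (ae_lebesgueI hU (ae_lebesgue_shift t hf))
    (ae_lebesgueI Tf (ae_lebesgueI he (ae_lebesgue_shift t he)))).
  move=> x [[h1 h2] [h3 [h4 h5]]] Ox Oxt.
  rewrite Ulin (multiplier_basis spec.2 mg) scalerA h1// h2// h3// h4// h5//.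
  by rewrite expoD; congr (_ + _); ring.
- apply: translates_closed fcl => u v.
  have m1 s l : Normc.normc (m s l) = 1 by exact: normc_expo.
  rewrite -(multiplier_sqn spec.2 m1 mg t (u - v)).
  congr (sqnorm _ _).
  by rewrite [u - v]addrC -[- v]scaleN1r Ulin scaleN1r [RHS]addrC.
Qed.

Lemma associated_group_unitary :
  strongly_continuous_unitary_group dot (associated_group spec).
Proof.
apply: (multiplier_group spec.2 (m := fun t l => expo (val l) t)).
- by move=> t l; exact: normc_expo.
- by move=> l; exact: expo0.
- by move=> s t l; exact: expoD.
- by move=> l t eps; exact: near_expo.
- exact: dot_associated_group.
Qed.

End associated_group_facts.

Theorem theorem2p2 (R : realType) (Omega : set (measurableTypeR R))
    (mOmega : measurable Omega) (bndOmega : bounded_set (Omega : set R))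
    (posOmega : (0 < lebesgue_measure Omega)%E)
    (Lambda : set R) (spec : is_spectrum mOmega Lambda) :
  local_translation_group (associated_group spec).
Proof.
split; first exact: associated_group_unitary.
move=> f t; exact: associated_group_translates.
Qed.
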